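(* Let $\mu$ be a freely infinitely divisible probability measure on $\mathbf{R}$ with free generating pair $(\gamma,\sigma)$, so that $\phi_\mu(z)=\gamma+\int_{\mathbf{R}}\frac{1+xz}{z-x}\,d\sigma(x)$ for $z\in\mathbf{C}^+$. Let $T>0$. Then the following are equivalent: (1) $\int_{\mathbf{R}}\log(1+x^2)\,d\mu(x)<\infty$; (2) $\int_{\mathbf{R}}\log(1+x^2)\,d\sigma(x)<\infty$; (3) $\int_T^\infty\frac{-\Im\phi_\mu(\mathrm{i}y)}{y^2}\,dy<\infty$; (4) $\int_0^{1/T}\Im R_\mu(\mathrm{i}y)\,dy<\infty$; (5) $\int_T^\infty\frac{\Im F_\mu(\mathrm{i}y)-y}{y^2}\,dy<\infty$.
   Context: For a probability measure $\mu$ on $\mathbf{R}$, $G_\mu(z)=\int\frac{d\mu(t)}{z-t}$ and $F_\mu=1/G_\mu$ on $\mathbf{C}^+$; the Voiculescu transform is $\phi_\mu(z)=F_\mu^{\langle-1\rangle}(z)-z$ on a truncated cone in $\mathbf{C}^+$. $\mu$ is freely infinitely divisible iff $\phi_\mu$ extends analytically to $\mathbf{C}^+$ with values in $\mathbf{C}^-\cup\mathbf{R}$, in which case there are unique $\gamma\in\mathbf{R}$ and finite positive Borel $\sigma$ giving the displayed representation (the free generating pair). Functions on $\mathbf{C}^+$ are extended to $\mathbf{C}^-$ by $f(z)=\overline{f(\bar z)}$. The $R$-transform is $R_\mu(w)=\phi_\mu(1/w)$; thus for $y>0$, $R_\mu(\mathrm{i}y)=\phi_\mu(-\mathrm{i}/y)=\overline{\phi_\mu(\mathrm{i}/y)}$,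 so $\Im R_\mu(\mathrm{i}y)=-\Im\phi_\mu(\mathrm{i}/y)\ge0$. *)

(* Defs.v *)
From HB Require Import structures.
From mathcomp Require Import all_boot all_order all_algebra.
From mathcomp Require Import complex.
From mathcomp Require Import all_classical all_reals all_analysis.

Set Implicit Arguments.
Unset Strict Implicit.
Unset Printing Implicit Defensive.

Import Order.TTheory GRing.Theory Num.Theory.
Local Open Scope ring_scope.
Local Open Scope complex_scope.

Section FreeID.
Variable R : realType.

Definition cintegral (nu : {measure set R -> \bar R}) (f : R -> R[i]) : R[i] :=
  (Rintegral nu setT (fun x => complex.Re (f x)))
    +i* (Rintegral nu setT (fun x => complex.Im (f x))).

Definition cauchy_transform (mu : {measure set R -> \bar R}) (z : R[i]) : R[i] :=
  cintegral mu (fun t => (z - t%:C)^-1).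

Definition F_transform (mu : {measure set R -> \bar R}) (z : R[i]) : R[i] :=
  (cauchy_transform mu z)^-1.

Definition LK_phi (gamma : R) (sigma : {measure set R -> \bar R}) (z : R[i]) : R[i] :=
  gamma%:C + cintegral sigma (fun x => (1 + x%:C * z) / (z - x%:C)).

Definition ext_lower (f : R[i] -> R[i]) (z : R[i]) : R[i] :=
  if 0 < complex.Im z then f z
  else (complex.Re (f (complex.Re z -i* complex.Im z)))
         -i* (complex.Im (f (complex.Re z -i* complex.Im z))).

Definition trunc_cone (alpha beta : R) : set R[i] :=
  [set z | `|complex.Re z| < alpha * complex.Im z /\ beta < complex.Im z].

(* (gamma, sigma) is the free generating pair of mu: on some truncated cone
   the right inverse of F_mu is z |-> z + phi(z), where phi is given by the
   Levy-Khintchine formula, i.e. phi_mu(z) = F_mu^{<-1>}(z) - z equals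
   gamma + int (1+xz)/(z-x) dsigma(x) there (hence, by analytic continuation,
   on all of C^+). *)
Definition free_generating_pair (mu : {measure set R -> \bar R}) (gamma : R)
  (sigma : {measure set R -> \bar R}) : Prop :=
  exists alpha beta : R, 0 < alpha /\ 0 < beta /\
    forall z, trunc_cone alpha beta z ->
      0 < complex.Im (z + LK_phi gamma sigma z) /\
      F_transform mu (z + LK_phi gamma sigma z) = z.

Definition R_transform (gamma : R) (sigma : {measure set R -> \bar R}) (w : R[i]) : R[i] :=
  ext_lower (LK_phi gamma sigma) w^-1.

End FreeID.

(* Main.v *)
Require Import Defs.
From HB Require Import structures.
From mathcomp Require Import all_boot all_order all_algebra.
From mathcomp Require Import complex.
From mathcomp Require Import all_classical all_reals all_analysis.
From mathcomp Require Import measurable_realfun.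
From mathcomp Require Import ring lra.
Import Order.TTheory GRing.Theory Num.Theory.
Import numFieldNormedType.Exports.
Local Open Scope ring_scope.
Local Open Scope classical_set_scope.

(**
For a finite measure nu put a_nu(y) = int x^2 / (x^2 + y^2) dnu(x). By Tonelli,
int_T^oo a_nu(y) / y dy = 1/2 int ln(1 + x^2 / T^2) dnu(x), so the logarithmic
moment of nu is finite iff a_nu(y) / y is integrable at infinity.

For sigma, - Im phi(iy) / y^2 lies between a_sigma(y) / y and
a_sigma(y) / y + sigma(R) / y^3; this settles (2) <-> (3), and (2) <-> (4) after
the inversion y -> 1/y.

For mu, let w = s + it with |s| <= t and G = G_mu(w). Then
Im F_mu(w) - t = t V / |G|^2, where V = int |1/(w-x)|^2 dmu - |G|^2 is a variance,
hence is unchanged when 1/(w-x) is replaced by h = 1/(w-x) - 1/w. Since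
|h|^2 is comparable to x^2 / (t^2 (x^2 + t^2)) and the mean of h is controlled by
the smallness of the tails of mu, (Im F_mu(w) - t) / t^2 is comparable to
a_mu(t) / t up to O(t^-3). Taking w = iy gives (1) <-> (5). Taking
w = iv + phi(iv), where F_mu(w) = iv, gives - Im phi(iv) = Im F_mu(w) - Im w with
w = iv (1 + o(1)), whence (1) <-> (3).
*)

(** * Comparison of integrals of nonnegative functions *)

Section integral_comparison.
Context {d : measure_display} {T : measurableType d} {R : realType}.
Variable mu : {measure set T -> \bar R}.
Local Open Scope ereal_scope.

(* Unlike [ge0_le_integral], no measurability is required: the integral of a
   nonnegative function is a supremum over the simple functions below it. *)
Lemma ge0_le_integral_subset (D E : set T) (f g : T -> \bar R) :
  D `<=` E -> (forall x, D x -> 0 <= f x <= g x) ->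
  (forall x, E x -> 0 <= g x) ->
  \int[mu]_(x in D) f x <= \int[mu]_(x in E) g x.
Proof.
move=> DE fg g0; rewrite !ge0_integralE//; last by move=> x /fg/andP[].
apply: le_ereal_sup => _ [h /= hf <-]; exists h => //= x.
apply: (le_trans (hf x)); rewrite !patchE.
case: ifPn => [/set_mem Dx|_]; first by rewrite mem_set ?(andP (fg x Dx)).2//; exact: DE.
by case: ifPn => // /set_mem/g0.
Qed.

(** Meant for an [f] whose measurability is unknown, such as the imaginary part of a transform. The
    function [k = max(0, (g - h) / C)] is measurable and lies below [f], so its integral is finite;
    then [g <= C k + h] involves measurable functions only, and additivity of the integral
    applies. *)
Lemma ge0_integral_lty_leD (D : set T) (f g h : T -> R) (C : R) :
  measurable D -> measurable_fun D g -> measurable_fun D h -> (0 < C)%R ->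
  (forall x, D x -> 0 <= f x)%R -> (forall x, D x -> 0 <= g x)%R ->
  (forall x, D x -> 0 <= h x)%R ->
  (forall x, D x -> g x <= C * f x + h x)%R ->
  \int[mu]_(x in D) (f x)%:E < +oo -> \int[mu]_(x in D) (h x)%:E < +oo ->
  \int[mu]_(x in D) (g x)%:E < +oo.
Proof.
move=> mD mg mh C0 f0 g0 h0 gfh foo hoo.
pose k x : R := Num.max 0%R ((g x - h x) / C)%R.
have mk : measurable_fun D k.
  apply: measurable_maxr => //; apply: measurable_funM => //.
  exact: measurable_funB.
have k0 x : (0 <= k x)%R by rewrite le_max lexx.
have koo : \int[mu]_(x in D) (k x)%:E < +oo.
  apply: le_lt_trans foo; apply: ge0_le_integral_subset => // x Dx.
  rewrite !lee_fin k0 ge_max f0//= ler_pdivrMr// lerBlDr mulrC; exact: gfh.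
apply: (@le_lt_trans _ _ (\int[mu]_(x in D) (C%:E * (k x)%:E + (h x)%:E))).
  apply: ge0_le_integral_subset => // x Dx.
    rewrite !lee_fin g0//= -lerBlDr mulrC -ler_pdivrMr//.
    by rewrite le_max lexx orbT.
  by rewrite lee_fin addr_ge0 ?h0// mulr_ge0// ltW.
have mk' : measurable_fun D (EFin \o k) by exact/measurable_EFinP.
have mh' : measurable_fun D (EFin \o h) by exact/measurable_EFinP.
rewrite ge0_integralD//=; last 2 first.
- by move=> x _; rewrite lee_fin mulr_ge0// ltW.
- exact: emeasurable_funM.
rewrite ge0_integralZl_EFin//; last 2 first.
- by move=> x _; rewrite lee_fin.
- exact: ltW.
by rewrite lte_add_pinfty// lte_mul_pinfty// ?lee_fin ?ltW.
Qed.

End integral_comparison.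

(** * Finite measures: bounded functions and tails *)

Section finite_measure.
Context {R : realType}.
Variable nu : {finite_measure set R -> \bar R}.

Lemma bounded_integrable (f : R -> R) (K : R) :
  measurable_fun setT f -> (forall x, `|f x| <= K) ->
  nu.-integrable setT (EFin \o f).
Proof.
move=> mf fK; apply: measurable_bounded_integrable => //.
  exact: fin_num_fun_lty (fin_num_measure nu).
exists K; split; first exact: num_real.
by move=> x Kx y _ /=; rewrite (le_trans (fK y))// ltW.
Qed.

Lemma EFin_Rintegral (f : R -> R) : nu.-integrable setT (EFin \o f) ->
  (\int[nu]_x f x)%:E = (\int[nu]_x (f x)%:E)%E.
Proof. by move=> fi; rewrite /Rintegral fineK//; exact: integrable_fin_num. Qed.

Lemma measurable_tail (M : R) : measurable [set x : R | M < `|x|].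
Proof.
have -> : [set x : R | M < `|x|] = (@Num.norm R R) @^-1` (`]M, +oo[).
  by apply/seteqP; split => x; rewrite /= in_itv/= andbT.
by rewrite -[X in measurable X]setTI; exact: normr_measurable.
Qed.

(** Continuity from above: the sets [|x| > n + 1] decrease to the empty set and have finite measure.
    The shift by one keeps [M] positive. *)
Lemma finite_measure_tail (e : R) : 0 < e ->
  exists2 M : R, 0 < M & fine (nu [set x | M < `|x|]) <= e.
Proof.
move=> e0; pose F n : set R := [set x | n.+1%:R < `|x|].
have mF n : measurable (F n) by exact: measurable_tail.
have F0 : \bigcap_n F n = set0.
  apply/seteqP; split => // x /(_ (Num.truncn `|x|) I) /=.
  by rewrite /F/= ltNge ltW// truncnS_gt.
have : nu (F n) @[n --> \oo] --> nu (\bigcap_n F n).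
  apply: nonincreasing_cvg_mu => //.
  - by rewrite ltey_eq fin_num_measure.
  - by rewrite F0.
  - move=> n m nm; apply/subsetPset => x /=; apply: le_lt_trans.
    by rewrite ler_nat.
rewrite F0 measure0 => /fine_cvgP[_ /cvgrPdist_lt /(_ _ e0)] [N _ /(_ N)].
rewrite /= sub0r normrN => /(_ (leqnn N)) /ltW h.
exists N.+1%:R => //; exact: le_trans (ler_norm _) h.
Qed.

End finite_measure.

(** * Measurability of the inverse and interchange of integrals *)

Section measurable_inverse.
Context {R : realType}.

Lemma measurable_invr : measurable_fun [set: R] (@GRing.inv R).
Proof.
(* The total function [x^-1] is discontinuous only at 0, where it takes the default value 0; the
   line is cut into that point and its open complement. *)
have -> : [set: R] = [set 0] `|` ~` [set 0] by rewrite setUv.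
apply/measurable_funU => //; first exact: measurableC.
split; first exact: measurable_fun_set1.
apply: open_continuous_measurable_fun.
  by apply: closed_openC; exact: closed_eq.
by move=> x; rewrite inE/= => /eqP x0; exact: inv_continuous.
Qed.

Lemma measurable_funV {d : measure_display} {T : measurableType d}
    (D : set T) (f : T -> R) :
  measurable_fun D f -> measurable_fun D (fun x => (f x)^-1).
Proof. by move=> mf; apply: measurableT_comp => //; exact: measurable_invr. Qed.

End measurable_inverse.

(** For each fixed [y] the bound [K y] makes the inner real-valued integral agree with the extended
    one; [K] itself may fail to be integrable. Multiplying the kernel by the indicator of [D]
    reduces the claim to Tonelli on the whole plane. *)
Lemma tonelli_Rintegral {R : realType} (nu : {finite_measure set R -> \bar R})
    (D : set R) (k : R -> R -> R) (K : R -> R) :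
  measurable D -> measurable_fun setT (fun p : R * R => k p.1 p.2) ->
  (forall x y, D y -> 0 <= k x y <= K y) ->
  (\int[lebesgue_measure]_(y in D) (\int[nu]_x k x y)%:E =
   \int[nu]_x \int[lebesgue_measure]_(y in D) (k x y)%:E)%E.
Proof.
move=> mD mk k0.
pose f (p : R * R) : \bar R := ((k p.1 p.2) * \1_D p.2)%:E.
have f0 p : (0 <= f p)%E.
  rewrite /f lee_fin indicE; case: (boolP (_ \in _)) => [/set_mem Dy|_].
    by rewrite mulr1; have /andP[] := k0 p.1 _ Dy.
  by rewrite mulr0.
have mf : measurable_fun setT f.
  apply/measurable_EFinP; apply: measurable_funM => //.
  by apply: measurableT_comp => //; exact: measurable_indic.
have /= := @fubini_tonelli _ _ _ _ _ nu lebesgue_measure f mf f0.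
transitivity (\int[lebesgue_measure]_y \int[nu]_x f (x, y))%E.
  rewrite integral_mkcond; apply: eq_integral => y _; rewrite patchE.
  case: ifPn => [/set_mem Dy|nDy].
    rewrite EFin_Rintegral.
      apply: eq_integral => x _; by rewrite /f/= indicE mem_set// mulr1.
    apply: (@bounded_integrable _ _ _ (K y)).
      exact: (@measurableT_comp _ _ _ _ _ _ (fun p => k p.1 p.2) _ (fun x => (x, y))).
    by move=> x; have /andP[? ?] := k0 x _ Dy; rewrite ger0_norm.
  by rewrite integral0_eq// => x _; rewrite /f/= indicE (negbTE nDy) mulr0.
rewrite -H; apply: eq_integral => x _.
rewrite [RHS]integral_mkcond; apply: eq_integral => y _; rewrite patchE /f/= indicE.
by case: ifPn => _; rewrite ?mulr1 ?mulr0.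
Qed.

(** * Explicit integrals of the logarithmic kernels *)

Section log_kernels.
Context {R : realType}.
Implicit Types x y T : R.

Lemma sqD_gt0 x y : 0 < y -> 0 < x ^+ 2 + y ^+ 2.
Proof. by move=> y0; rewrite ltr_wpDl ?sqr_ge0// exprn_gt0. Qed.

Lemma integral_log_kernely T x : 0 < T ->
  (\int[lebesgue_measure]_(y in `[T, +oo[)
     (x ^+ 2 / (y * (x ^+ 2 + y ^+ 2)))%:E = (ln (1 + x ^+ 2 / T ^+ 2) / 2)%:E)%E.
Proof.
move=> T0.
(* A primitive of the kernel. This form is easy to differentiate; the form in [FE] shows that it
   tends to 0 at infinity, so only the endpoint [T] contributes. *)
pose F y : R := ln y - 2^-1 * ln (x ^+ 2 + y ^+ 2).
have FE y : 0 < y -> F y = - (ln (1 + x ^+ 2 / y ^+ 2) / 2).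
  move=> y0; rewrite /F.
  have -> : x ^+ 2 + y ^+ 2 = y ^+ 2 * (1 + x ^+ 2 / y ^+ 2).
    by field; rewrite gt_eqF.
  rewrite lnM ?posrE ?exprn_gt0//; last first.
    by rewrite ltr_wpDr// divr_ge0 ?sqr_ge0.
  by rewrite lnXn//; field.
have F' y : 0 < y -> is_derive y 1 F (x ^+ 2 / (y * (x ^+ 2 + y ^+ 2))).
  move=> y0.
  have h1 : is_derive y 1 (@ln R) y^-1 by exact: is_derive1_ln.
  have h2 : is_derive y 1 (fun y => x ^+ 2 + y ^+ 2) (2 * y).
    have -> : (fun y => x ^+ 2 + y ^+ 2) = cst (x ^+ 2) + (id ^+ 2 : R -> R).
      by apply/funext => z.
    apply: is_derive_eq.
    by rewrite add0r /= expr1 -[_ *: _]/(_ * _) mulr1 mulr_natl.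
  have h3 : is_derive y 1 (@ln R \o (fun y => x ^+ 2 + y ^+ 2))
      ((x ^+ 2 + y ^+ 2)^-1 * (2 * y)).
    apply: is_derive1_comp; apply: is_derive1_ln; exact: sqD_gt0.
  have -> : F = @ln R - 2^-1 *: (@ln R \o (fun y => x ^+ 2 + y ^+ 2)).
    by apply/funext.
  apply: is_derive_eq; rewrite -[_ *: _]/(_ * _).
  by field; rewrite !gt_eqF ?sqD_gt0.
rewrite (@ge0_continuous_FTC2y _ _ F T 0).
- by rewrite FE// sub0e EFinN oppeK.
- move=> y Ty; have y0 := lt_le_trans T0 Ty.
  by rewrite divr_ge0 ?sqr_ge0// ltW// mulr_gt0// sqD_gt0.
- apply/continuous_in_subspaceT => y; rewrite inE/= in_itv/= andbT => Ty.
  have y0 := lt_le_trans T0 Ty.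
  apply: cvgM; first exact: cvg_cst.
  apply: cvgV; first by rewrite gt_eqF// mulr_gt0// sqD_gt0.
  apply: cvgM; first exact: cvg_id.
  by apply: cvgD; [exact: cvg_cst|exact: exprn_continuous].
- apply/cvgrPdist_le => e e0; near=> y.
  have y0 : 0 < y by near: y; exact: nbhs_pinfty_gt.
  have xy0 : 0 <= x ^+ 2 / y ^+ 2 by rewrite divr_ge0 ?sqr_ge0.
  rewrite FE// sub0r opprK ger0_norm; last first.
    by rewrite divr_ge0// ln_ge0// lerDl.
  (* By [ln (1 + u) <= u] it suffices to make [x^2 / y^2] small, which holds once [y >= 1] and
     [y >= x^2 / e]. *)
  rewrite ler_pdivrMr//; apply: (@le_trans _ _ (x ^+ 2 / y ^+ 2)).
    by apply: le_ln1Dx; rewrite (lt_le_trans _ xy0)// oppr_lt0.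
  rewrite ler_pdivrMr ?exprn_gt0//.
  have y1 : 1 <= y by near: y; apply: nbhs_pinfty_ge; exact: num_real.
  have yx : x ^+ 2 / e <= y by near: y; apply: nbhs_pinfty_ge; exact: num_real.
  move: yx; rewrite ler_pdivrMr// => yx.
  by rewrite (le_trans yx)//; nra.
- move=> y Ty; have y0 := lt_trans T0 Ty.
  by have [] := F' _ y0.
- apply: cvg_at_right_filter; apply: differentiable_continuous.
  by apply/derivable1_diffP; have [] := F' _ T0.
- move=> y; rewrite in_itv/= andbT => Ty; have y0 := lt_trans T0 Ty.
  by rewrite derive1E; have := F' _ y0 => H; rewrite derive_val.
Unshelve. all: by end_near. Qed.

(** The kernel of [integral_log_kernely] after the inversion [y -> 1/y]. Instead of a change of
    variables, the primitive [ln (1 + x^2 y^2) / 2] is used; it is smooth up to 0, so the endpoint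
    can be added and the fundamental theorem applied on a compact interval. *)
Lemma integral_log_kernel0 T x : 0 < T ->
  (\int[lebesgue_measure]_(y in `]0%R, (T^-1)%R])
     (x ^+ 2 * y / (1 + x ^+ 2 * y ^+ 2))%:E = (ln (1 + x ^+ 2 / T ^+ 2) / 2)%:E)%E.
Proof.
move=> T0.
have p0 y : 0 < 1 + x ^+ 2 * y ^+ 2 by rewrite ltr_wpDr// mulr_ge0// sqr_ge0.
pose F y : R := 2^-1 * ln (1 + x ^+ 2 * y ^+ 2).
have F' y : is_derive y 1 F (x ^+ 2 * y / (1 + x ^+ 2 * y ^+ 2)).
  have h2 : is_derive y 1 (fun y => 1 + x ^+ 2 * y ^+ 2) (x ^+ 2 * (2 * y)).
    have -> : (fun y => 1 + x ^+ 2 * y ^+ 2) =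
        cst 1 + x ^+ 2 *: (id ^+ 2 : R -> R).
      by apply/funext => z.
    apply: is_derive_eq.
    by rewrite add0r /= expr1 -[_ *: _]/(_ * _) -[_ *: _]/(_ * _) mulr1 mulr_natl.
  have h3 : is_derive y 1 (@ln R \o (fun y => 1 + x ^+ 2 * y ^+ 2))
      ((1 + x ^+ 2 * y ^+ 2)^-1 * (x ^+ 2 * (2 * y))).
    by apply: is_derive1_comp; exact: is_derive1_ln.
  have -> : F = 2^-1 *: (@ln R \o (fun y => 1 + x ^+ 2 * y ^+ 2)).
    by apply/funext.
  apply: is_derive_eq; rewrite -[_ *: _]/(_ * _).
  by field; rewrite gt_eqF// exprMn.
have cF y : {for y, continuous F}.
  apply: differentiable_continuous.
  by apply/derivable1_diffP; have [] := F' y.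
have cf : continuous (fun y => x ^+ 2 * y / (1 + x ^+ 2 * y ^+ 2)).
  move=> y; apply: cvgM.
    by apply: cvgM; [exact: cvg_cst|exact: cvg_id].
  apply: cvgV; first by rewrite gt_eqF.
  apply: cvgD; first exact: cvg_cst.
  by apply: cvgM; [exact: cvg_cst|exact: exprn_continuous].
rewrite integral_itv_obnd_cbnd; last first.
  apply/measurable_EFinP; apply: measurable_funTS.
  exact: continuous_measurable_fun.
rewrite (@continuous_FTC2 _ _ F 0 T^-1); first last.
- by move=> y _; rewrite derive1E; have H := F' y; rewrite derive_val.
- split.
  + by move=> y _; have [] := F' y.
  + by apply: cvg_at_right_filter; exact: cF.
  + by apply: cvg_at_left_filter; exact: cF.
- exact: continuous_subspaceT.
- by rewrite invr_gt0.
rewrite /F expr0n/= mulr0 addr0 ln1 mulr0 sube0 exprVn; congr EFin; lra.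
Qed.

End log_kernels.

(** * The truncated second moment and its relation to the logarithmic moment *)

(** This is [a_nu(y)]. For [y > 0] the weight is bounded by 1 and acts as a smoothed indicator of
    [|x| > y], so the integral is finite for every finite measure. *)
Definition trunc_moment {R : realType} (nu : {measure set R -> \bar R}) (y : R) : R :=
  \int[nu]_x (x ^+ 2 / (x ^+ 2 + y ^+ 2)).

Section trunc_moment.
Context {R : realType}.
Variable nu : {finite_measure set R -> \bar R}.
Implicit Types x y T C : R.

Lemma sq_div_sqD_itv x y : 0 < y -> 0 <= x ^+ 2 / (x ^+ 2 + y ^+ 2) <= 1.
Proof.
move=> y0; have p0 := sqD_gt0 x y y0.
apply/andP; split; first by rewrite divr_ge0 ?sqr_ge0 ?ltW.
by rewrite ler_pdivrMr// mul1r lerDl sqr_ge0.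
Qed.

Lemma measurable_sq_div_sqD y :
  measurable_fun [set: R] (fun x => x ^+ 2 / (x ^+ 2 + y ^+ 2)).
Proof.
apply: measurable_funM; first exact: measurable_funX.
by apply: measurable_funV; apply: measurable_funD => //; exact: measurable_funX.
Qed.

Lemma integrable_trunc_moment y : 0 < y ->
  nu.-integrable setT (EFin \o (fun x => x ^+ 2 / (x ^+ 2 + y ^+ 2))).
Proof.
move=> y0; apply: (@bounded_integrable _ _ _ 1); first exact: measurable_sq_div_sqD.
by move=> x; have /andP[? ?] := sq_div_sqD_itv x y y0; rewrite ger0_norm.
Qed.

Lemma trunc_moment_ge0 y : 0 <= trunc_moment nu y.
Proof.
by apply: Rintegral_ge0 => x _; rewrite divr_ge0 ?addr_ge0 ?sqr_ge0.
Qed.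

Lemma measurable_trunc_moment : measurable_fun setT (trunc_moment nu).
Proof.
rewrite /trunc_moment /Rintegral; apply: measurableT_comp => //.
pose f (p : R * R) : \bar R := (p.1 ^+ 2 / (p.1 ^+ 2 + p.2 ^+ 2))%:E.
apply: (@measurable_fun_fubini_tonelli_G _ _ _ _ _ nu f).
  apply/measurable_EFinP; apply: measurable_funM; first exact: measurable_funX.
  by apply: measurable_funV; apply: measurable_funD => //; exact: measurable_funX.
by move=> p; rewrite lee_fin divr_ge0 ?addr_ge0 ?sqr_ge0.
Qed.

Lemma measurable_trunc_moment_div (D : set R) :
  measurable_fun D (fun y => trunc_moment nu y / y).
Proof.
apply: measurable_funTS; apply: measurable_funM.
  exact: measurable_trunc_moment.
exact: measurable_funV.
Qed.

Lemma trunc_moment_nincr y z : 0 < y -> y <= z ->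
  trunc_moment nu z <= trunc_moment nu y.
Proof.
move=> y0 yz; have z0 := lt_le_trans y0 yz.
apply: le_Rintegral => //; try exact: integrable_trunc_moment.
move=> x _; rewrite ler_wpM2l ?sqr_ge0// lef_pV2 ?posrE ?sqD_gt0//.
by rewrite lerD2l ler_pXn2r ?nnegrE ?(ltW y0) ?(ltW z0).
Qed.

(** Pointwise, [z <= 2 y] gives [x^2 + z^2 <= 4 (x^2 + y^2)]. Together with [trunc_moment_nincr]
    this allows passing between comparable heights at the cost of a constant. *)
Lemma trunc_moment_half y z : 0 < z -> z <= 2 * y -> 0 < y ->
  trunc_moment nu y <= 4 * trunc_moment nu z.
Proof.
move=> z0 yz y0; rewrite /trunc_moment -RintegralZl//; last first.
  exact: integrable_trunc_moment.
apply: le_Rintegral => //; first exact: integrable_trunc_moment.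
  apply: (@bounded_integrable _ _ _ 4).
    by apply: measurable_funM => //; exact: measurable_sq_div_sqD.
  move=> x; have /andP[? ?] := sq_div_sqD_itv x z z0.
  rewrite ger0_norm; lra.
move=> x _; rewrite mulrCA ler_wpM2l ?sqr_ge0//.
rewrite -[leLHS]mul1r ler_pdivrMr ?sqD_gt0// mulrAC ler_pdivlMr ?sqD_gt0//.
nra.
Qed.

Lemma integral_trunc_momenty T : 0 < T ->
  (\int[lebesgue_measure]_(y in `[T, +oo[) (trunc_moment nu y / y)%:E =
   \int[nu]_x (ln (1 + x ^+ 2 / T ^+ 2) / 2)%:E)%E.
Proof.
move=> T0.
transitivity (\int[lebesgue_measure]_(y in `[T, +oo[)
    (\int[nu]_x (x ^+ 2 / (y * (x ^+ 2 + y ^+ 2))))%:E)%E.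
  apply: eq_integral => y /set_mem/=; rewrite in_itv/= andbT => Ty.
  have y0 := lt_le_trans T0 Ty.
  rewrite /trunc_moment -RintegralZr//; last exact: integrable_trunc_moment.
  congr EFin; apply: eq_Rintegral => x _.
  by field; rewrite !gt_eqF ?sqD_gt0.
rewrite (@tonelli_Rintegral _ _ _ _ (fun y => y^-1))//.
- by apply: eq_integral => x _; rewrite integral_log_kernely.
- apply: measurable_funM; first exact: measurable_funX.
  apply: measurable_funV; apply: measurable_funM => //.
  by apply: measurable_funD => //; exact: measurable_funX.
- move=> x y /=; rewrite in_itv/= andbT => Ty.
  have y0 := lt_le_trans T0 Ty.
  have /andP[h0 h1] := sq_div_sqD_itv x y y0.
  have -> : x ^+ 2 / (y * (x ^+ 2 + y ^+ 2)) = y^-1 * (x ^+ 2 / (x ^+ 2 + y ^+ 2)).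
    by field; rewrite !gt_eqF ?sqD_gt0.
  by rewrite mulr_ge0 ?invr_ge0 ?(ltW y0)//= ler_piMr// invr_ge0 ltW.
Qed.

Lemma integral_trunc_moment0 T : 0 < T ->
  (\int[lebesgue_measure]_(y in `]0%R, (T^-1)%R]) (trunc_moment nu y^-1 / y)%:E =
   \int[nu]_x (ln (1 + x ^+ 2 / T ^+ 2) / 2)%:E)%E.
Proof.
move=> T0.
transitivity (\int[lebesgue_measure]_(y in `]0%R, (T^-1)%R])
    (\int[nu]_x (x ^+ 2 * y / (1 + x ^+ 2 * y ^+ 2)))%:E)%E.
  apply: eq_integral => y /set_mem/=; rewrite in_itv/= => /andP[y0 _].
  have p0 x : 0 < 1 + x ^+ 2 * y ^+ 2 by rewrite ltr_wpDr// mulr_ge0// sqr_ge0.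
  have yV0 : 0 < y^-1 by rewrite invr_gt0.
  rewrite /trunc_moment -RintegralZr//; last exact: integrable_trunc_moment.
  congr EFin; apply: eq_Rintegral => x _.
  by field; rewrite exprMn !gt_eqF.
rewrite (@tonelli_Rintegral _ _ _ _ (fun y => y^-1))//.
- by apply: eq_integral => x _; rewrite integral_log_kernel0.
- apply: measurable_funM.
    by apply: measurable_funM => //; exact: measurable_funX.
  apply: measurable_funV; apply: measurable_funD => //.
  by apply: measurable_funM; exact: measurable_funX.
- move=> x y /=; rewrite in_itv/= => /andP[y0 _].
  have p0 : 0 < 1 + x ^+ 2 * y ^+ 2 by rewrite ltr_wpDr// mulr_ge0// sqr_ge0.
  have n0 : 0 <= x ^+ 2 * y by rewrite mulr_ge0 ?sqr_ge0// ltW.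
  rewrite divr_ge0 ?(ltW p0)//=.
  rewrite ler_pdivrMr// ler_pdivlMl//.
  have -> : y * (x ^+ 2 * y) = x ^+ 2 * y ^+ 2 by ring.
  by rewrite lerDr.
Qed.

(** Rescaling [x] changes the logarithm by at most a constant, because
    [1 + x^2/c <= (1 + x^2/e) (1 + e/c)], and constants are integrable for a finite measure. *)
Lemma log_integral_lty T : 0 < T ->
  (\int[nu]_x (ln (1 + x ^+ 2 / T ^+ 2) / 2)%:E < +oo)%E <->
  (\int[nu]_x (ln (1 + x ^+ 2))%:E < +oo)%E.
Proof.
move=> T0.
have mln (c : R) : measurable_fun [set: R] (fun x => ln (1 + x ^+ 2 / c)).
  apply: measurableT_comp => //.
  apply: measurable_funD => //; apply: measurable_funM => //.
have ln0 (c x : R) : 0 < c -> 0 <= ln (1 + x ^+ 2 / c).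
  by move=> c0; rewrite ln_ge0// lerDl divr_ge0 ?sqr_ge0// ltW.
have lncmp (c e x : R) : 0 < c -> 0 < e ->
    ln (1 + x ^+ 2 / c) <= ln (1 + x ^+ 2 / e) + ln (1 + e / c).
  move=> c0 e0.
  have xc0 : 0 <= x ^+ 2 / c by rewrite divr_ge0 ?sqr_ge0 ?ltW.
  have xe0 : 0 <= x ^+ 2 / e by rewrite divr_ge0 ?sqr_ge0 ?ltW.
  have ec0 : 0 <= e / c by rewrite divr_ge0 ?ltW.
  have -> : ln (1 + x ^+ 2 / e) + ln (1 + e / c) =
      ln (1 + x ^+ 2 / c + (x ^+ 2 / e + e / c)).
    rewrite -lnM ?posrE ?ltr_wpDr//; congr ln.
    by field; rewrite !gt_eqF.
  by rewrite ler_ln ?posrE ?ltr_wpDr ?addr_ge0// lerDl addr_ge0.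
have cst_lty (c : R) : (\int[nu]_(x in [set: R]) c%:E < +oo)%E.
  rewrite integral_cst//= ltey_eq fin_numM//.
  exact: fin_num_measure.
have T20 : 0 < T ^+ 2 by rewrite exprn_gt0.
have divr1E : (fun x => ln (1 + x ^+ 2)) = (fun x : R => ln (1 + x ^+ 2 / 1)).
  by apply/funext => x; rewrite divr1.
split.
- move=> h; move: h (cst_lty (ln (1 + T ^+ 2 / 1))).
  apply: (@ge0_integral_lty_leD _ _ _ _ _ _ _ (fun=> ln (1 + T ^+ 2 / 1)) 2) => //.
  + by rewrite divr1E; exact: mln.
  + by move=> x _; rewrite divr_ge0// ln0.
  + by move=> x _; rewrite -[x ^+ 2]divr1 ln0.
  + by move=> x _; rewrite ln_ge0// lerDl divr1 ltW.
  + move=> x _; rewrite mulrCA divff// mulr1 -[x ^+ 2 in leLHS]divr1.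
    exact: lncmp.
- move=> h; move: h (cst_lty (ln (1 + 1 / T ^+ 2))).
  apply: (@ge0_integral_lty_leD _ _ _ _ _ _ _ (fun=> ln (1 + 1 / T ^+ 2)) 1) => //.
  + by apply: measurable_funM => //; exact: mln.
  + by move=> x _; rewrite -[x ^+ 2]divr1 ln0.
  + by move=> x _; rewrite divr_ge0// ln0.
  + by move=> x _; rewrite ln_ge0// lerDl divr_ge0// ltW.
  + move=> x _; rewrite mul1r -[x ^+ 2 in leRHS]divr1.
    apply: (@le_trans _ _ (ln (1 + x ^+ 2 / T ^+ 2))); last exact: lncmp.
    by rewrite ler_pdivrMr// ler_peMr ?ln0// ler1n.
Qed.

Lemma trunc_moment_log T : 0 < T ->
  (\int[lebesgue_measure]_(y in `[T, +oo[) (trunc_moment nu y / y)%:E < +oo)%E <->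
  (\int[nu]_x (ln (1 + x ^+ 2))%:E < +oo)%E.
Proof. by move=> T0; rewrite integral_trunc_momenty// log_integral_lty. Qed.

Lemma trunc_moment_log0 T : 0 < T ->
  (\int[lebesgue_measure]_(y in `]0%R, (T^-1)%R])
     (trunc_moment nu y^-1 / y)%:E < +oo)%E <->
  (\int[nu]_x (ln (1 + x ^+ 2))%:E < +oo)%E.
Proof. by move=> T0; rewrite integral_trunc_moment0// log_integral_lty. Qed.

End trunc_moment.

(** * Integrability of the error terms *)

Lemma integral_invX3_lty {R : realType} (T C : R) : 0 < T -> 0 <= C ->
  (\int[lebesgue_measure]_(y in `[T, +oo[) (C / y ^+ 3)%:E < +oo)%E.
Proof.
move=> T0 C0.
have := @integral_log_kernely R T 1 T0; rewrite expr1n => E.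
(* For [y >= T] one has [1 + y^2 <= (1 + 1/T^2) y^2], so [C / y^3] is at most [K] times the
   logarithmic kernel at [x = 1], whose integral is known. *)
pose K := C * (1 + 1 / T ^+ 2).
apply: (@le_lt_trans _ _ (\int[lebesgue_measure]_(y in `[T, +oo[)
    (K%:E * (1 / (y * (1 + y ^+ 2)))%:E))%E).
  have K0 : 0 <= K by rewrite mulr_ge0// addr_ge0// divr_ge0// exprn_ge0// ltW.
  apply: ge0_le_integral_subset => // y /=; rewrite in_itv/= andbT => Ty;
    have y0 := lt_le_trans T0 Ty.
    rewrite !lee_fin; apply/andP; split.
      by rewrite divr_ge0// exprn_ge0// ltW.
    rewrite /K -mulrA ler_wpM2l//.
    rewrite -[leLHS]mul1r ler_pdivrMr ?exprn_gt0//.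
    have -> : (1 + 1 / T ^+ 2) * (1 / (y * (1 + y ^+ 2))) * y ^+ 3 =
        (y ^+ 2 + y ^+ 2 / T ^+ 2) / (1 + y ^+ 2).
      by field; rewrite !gt_eqF ?ltr_wpDr ?sqr_ge0.
    rewrite ler_pdivlMr ?ltr_wpDr ?sqr_ge0// mul1r addrC lerD2l.
    by rewrite ler_pdivlMr ?exprn_gt0// mul1r ler_pXn2r ?nnegrE// ltW.
  rewrite lee_fin mulr_ge0// divr_ge0// mulr_ge0 ?addr_ge0 ?sqr_ge0 ?ltW//.
rewrite ge0_integralZl_EFin//.
- by rewrite E -EFinM ltry.
- move=> y /=; rewrite in_itv/= andbT => Ty; have y0 := lt_le_trans T0 Ty.
  by rewrite lee_fin divr_ge0// mulr_ge0 ?addr_ge0 ?sqr_ge0 ?ltW.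
- apply/measurable_EFinP; apply: measurable_funTS; apply: measurable_funM => //.
  apply: measurable_funV; apply: measurable_funM => //.
  by apply: measurable_funD => //; exact: measurable_funX.
- by rewrite mulr_ge0// addr_ge0// divr_ge0// exprn_ge0// ltW.
Qed.

Lemma integral_linear0_lty {R : realType} (T C : R) : 0 < T -> 0 <= C ->
  (\int[lebesgue_measure]_(y in `]0%R, (T^-1)%R]) (C * y)%:E < +oo)%E.
Proof.
move=> T0 C0.
apply: (@le_lt_trans _ _ (\int[lebesgue_measure]_(y in `]0%R, (T^-1)%R])
    (cst (C / T)%:E) y))%E.
  apply: ge0_le_integral_subset => // y /=; rewrite in_itv/= => /andP[y0 yT];
    rewrite !lee_fin.
    by rewrite mulr_ge0 ?(ltW y0)//= ler_wpM2l.
  by rewrite divr_ge0// ltW.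
rewrite integral_cst//= lebesgue_measure_itv/= lte_fin invr_gt0 T0.
by rewrite -EFinB -EFinM ltry.
Qed.

(** * Expectations and variances of bounded functions *)

(** A class closed under sums and products and integrable for every finite measure, so that
    linearity and monotonicity of the integral need no separate integrability argument. *)
Definition bounded_measurable {R : realType} (f : R -> R) :=
  measurable_fun setT f /\ exists K, forall x, `|f x| <= K.

Section bounded_measurable.
Context {R : realType}.
Implicit Types f g : R -> R.

Lemma bounded_measurable_cst (c : R) : bounded_measurable (fun=> c).
Proof. by split=> //; exists `|c|. Qed.

Lemma bounded_measurableD f g : bounded_measurable f -> bounded_measurable g ->
  bounded_measurable (fun x => f x + g x).
Proof.
move=> [mf [K fK]] [mg [L gL]]; split; first exact: measurable_funD.
by exists (K + L) => x; rewrite (le_trans (ler_normD _ _))// lerD.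
Qed.

Lemma bounded_measurableM f g : bounded_measurable f -> bounded_measurable g ->
  bounded_measurable (fun x => f x * g x).
Proof.
move=> [mf [K fK]] [mg [L gL]]; split; first exact: measurable_funM.
by exists (K * L) => x; rewrite normrM ler_pM.
Qed.

Lemma bounded_measurableZ (c : R) f : bounded_measurable f ->
  bounded_measurable (fun x => c * f x).
Proof. exact/bounded_measurableM/bounded_measurable_cst. Qed.

Lemma bounded_measurableX2 f : bounded_measurable f ->
  bounded_measurable (fun x => f x ^+ 2).
Proof. by move=> bf; exact: bounded_measurableM. Qed.

Lemma bounded_measurable_integrable (nu : {finite_measure set R -> \bar R}) f :
  bounded_measurable f -> nu.-integrable setT (EFin \o f).
Proof. by move=> [mf [K fK]]; exact: bounded_integrable fK. Qed.

Lemma bounded_measurable_sq_div_sqD (y : R) : 0 < y ->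
  bounded_measurable (fun x : R => x ^+ 2 / (x ^+ 2 + y ^+ 2)).
Proof.
move=> y0; split; first exact: measurable_sq_div_sqD.
by exists 1 => x; have /andP[? ?] := sq_div_sqD_itv x y y0; rewrite ger0_norm.
Qed.

End bounded_measurable.

Section expectation.
Context {R : realType}.
Variable mu : probability R R.
Implicit Types f g : R -> R.
Local Notation E f := (\int[mu]_x f x).
Let bmi := @bounded_measurable_integrable R mu.

Lemma expect_cst (c : R) : E (fun=> c) = c.
Proof.
rewrite (@Rintegral_cst _ _ _ mu setT measurableT).
have -> : fine (mu setT) = 1 by rewrite probability_setT.
by rewrite mulr1.
Qed.

Lemma expectD f g : bounded_measurable f -> bounded_measurable g ->
  \int[mu]_x (f x + g x) = E f + E g.
Proof. by move=> bf bg; apply: RintegralD => //; exact: bmi. Qed.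

Lemma expectZ (c : R) f : bounded_measurable f ->
  \int[mu]_x (c * f x) = c * E f.
Proof. by move=> bf; apply: RintegralZl => //; exact: bmi. Qed.

Lemma le_expect f g : bounded_measurable f -> bounded_measurable g ->
  (forall x, f x <= g x) -> E f <= E g.
Proof. by move=> bf bg fg; apply: le_Rintegral => //; exact: bmi. Qed.

(** Both sides are the variance of [f]. Later [c] is the real or imaginary part of [1/w], which
    turns [1/(w-x)] into a function vanishing at [x = 0]. *)
Lemma variance_shift f (c : R) : bounded_measurable f ->
  \int[mu]_x (f x ^+ 2) - E f ^+ 2 =
  \int[mu]_x ((f x - c) ^+ 2) - (E f - c) ^+ 2.
Proof.
move=> bf.
have -> : \int[mu]_x ((f x - c) ^+ 2) =
    \int[mu]_x (f x ^+ 2) + (- (2 * c) * E f + c ^+ 2).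
  rewrite -(expect_cst (c ^+ 2)) -expectZ// -expectD; last 2 first.
  - exact: bounded_measurableZ.
  - exact: bounded_measurable_cst.
  rewrite -expectD.
  - by apply: eq_Rintegral => x _; ring.
  - exact: bounded_measurableX2.
  - apply: bounded_measurableD; first exact: bounded_measurableZ.
    exact: bounded_measurable_cst.
ring.
Qed.

Lemma sqr_expect_le f : bounded_measurable f -> E f ^+ 2 <= \int[mu]_x (f x ^+ 2).
Proof.
(* Shifting by the mean itself writes the variance as the integral of a square. *)
move=> bf; rewrite -subr_ge0 (variance_shift f (E f))// subrr expr0n/= subr0.
by apply: Rintegral_ge0 => x _; exact: sqr_ge0.
Qed.

Lemma bounded_measurable_tail (M : R) :
  bounded_measurable (\1_[set x : R | M < `|x|] : R -> R).
Proof.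
split; first by apply: measurable_indic; exact: measurable_tail.
by exists 1 => x; rewrite indicE; case: (_ \in _); rewrite ?normr1 ?normr0.
Qed.

Lemma Rintegral_tail (nu : {finite_measure set R -> \bar R}) (M : R) :
  \int[nu]_x (\1_[set x : R | M < `|x|] x) = fine (nu [set x : R | M < `|x|]).
Proof.
rewrite /Rintegral integral_indic//; last exact: measurable_tail.
by rewrite setIT.
Qed.

(* With [e = E f], integrate [e f <= |e| K + f^2 / 8 + 2 e^2 1_{|x| > M}]. *)
Lemma sqr_expect_le_tail f (K M : R) : bounded_measurable f -> 0 <= K ->
  fine (mu [set x | M < `|x|]) <= 8^-1 -> (forall x, `|x| <= M -> `|f x| <= K) ->
  E f ^+ 2 <= 2 * K ^+ 2 + \int[mu]_x (f x ^+ 2) / 4.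
Proof.
move=> bf K0 PM fK; set e := E f; set S := \int[mu]_x (f x ^+ 2).
have bA := bounded_measurable_tail M.
have bf2 := bounded_measurableX2 _ bf.
have : \int[mu]_x (e * f x) <= \int[mu]_x (`|e| * K +
    (8^-1 * f x ^+ 2 + (2 * e ^+ 2) * \1_[set x : R | M < `|x|] x)).
  apply: le_expect.
  - exact: bounded_measurableZ.
  - apply: bounded_measurableD; first exact: bounded_measurable_cst.
    by apply: bounded_measurableD; exact: bounded_measurableZ.
  - move=> x; rewrite indicE; case: (boolP (_ \in _)) => [_|].
      rewrite mulr1; have := mulr_ge0 (normr_ge0 e) K0.
      have := sqr_ge0 (f x / 2 - 2 * e); nra.
    rewrite notin_setE/= => /negP; rewrite -leNgt => /fK fxK.
    rewrite mulr0 addr0 (le_trans (ler_norm _))// normrM.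
    rewrite ler_wpDr ?ler_wpM2l//.
    by have := sqr_ge0 (f x); lra.
have b1 := bounded_measurable_cst (`|e| * K).
have b2 := bounded_measurableZ 8^-1 _ bf2.
have b3 := bounded_measurableZ (2 * e ^+ 2) _ bA.
have b23 := bounded_measurableD _ _ b2 b3.
rewrite expectZ// expectD// expect_cst expectD// !expectZ// Rintegral_tail.
rewrite -/e -/S; set P := fine _ in PM *.
have : 0 <= P by rewrite /P fine_ge0.
have -> : e ^+ 2 = `|e| ^+ 2 by rewrite real_normK// num_real.
have -> : e * e = `|e| ^+ 2 by rewrite -expr2 real_normK// num_real.
have := normr_ge0 e; move: `|e| => n n0 P0 h.
(* The tail term is thus at most [n^2 / 4], and [n K <= n^2 / 4 + K^2]; half of [n^2] survives on
   the left, which yields the constants [2] and [1/4]. *)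
have : n ^+ 2 * P <= n ^+ 2 * 8^-1 by rewrite ler_wpM2l ?sqr_ge0.
have := sqr_ge0 (n / 2 - K); nra.
Qed.

End expectation.

(** * Two-sided estimates of [Im F_mu] in the cone [|s| <= t] *)

Section F_transform_estimates.
Context {R : realType}.
Variables (mu : probability R R) (s t M : R).
Hypotheses (t_gt0 : 0 < t) (st : `|s| <= t).
Hypotheses (M_gt0 : 0 < M) (tailM : fine (mu [set x | M < `|x|]) <= 8^-1).
Local Notation E f := (\int[mu]_x f x).

(** With [w = s + it]: [d x] is [|w - x|^2] and [W] is [|w|^2]; [f1], [f2] are the real and
    imaginary parts of [1/(w-x)], and [h1], [h2] those of [1/(w-x) - 1/w]. [N] is [|G_mu(w)|^2], [H]
    is the mean of [|h|^2], and [V] is the variance of [1/(w-x)]. *)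
Let d x := (s - x) ^+ 2 + t ^+ 2.
Let f1 x := (s - x) / d x.
Let f2 x := - (t / d x).
Let W := s ^+ 2 + t ^+ 2.
Let h1 x := f1 x - s / W.
Let h2 x := f2 x - - (t / W).
Let H := \int[mu]_x (h1 x ^+ 2) + \int[mu]_x (h2 x ^+ 2).
Let N := E f1 ^+ 2 + E f2 ^+ 2.
Let V := \int[mu]_x (f1 x ^+ 2) + \int[mu]_x (f2 x ^+ 2) - N.
Let a := trunc_moment mu t.

Let d_gt0 x : 0 < d x.
Proof. exact: sqD_gt0. Qed.

Let W_gt0 : 0 < W. Proof. exact: sqD_gt0. Qed.

Let s2t2 : s ^+ 2 <= t ^+ 2.
Proof. by rewrite -[s ^+ 2]real_normK ?num_real// ler_pXn2r ?nnegrE// ltW. Qed.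

Let measurable_dV : measurable_fun [set: R] (fun x => (d x)^-1).
Proof.
apply: measurable_funV; apply: measurable_funD => //.
by apply: measurable_funX; exact: measurable_funB.
Qed.

Let f12E x : f1 x ^+ 2 + f2 x ^+ 2 = (d x)^-1.
Proof.
rewrite /f1 /f2 sqrrN !expr_div_n -mulrDl.
by rewrite -/(d x) expr2 invfM mulrA divff ?mul1r// gt_eqF.
Qed.

Let dV_le x : (d x)^-1 <= (t ^+ 2)^-1.
Proof. by rewrite lef_pV2 ?posrE ?exprn_gt0// lerDr sqr_ge0. Qed.

Let sqr_le_bound (u v : R) : 0 <= v -> u ^+ 2 <= v ^+ 2 -> `|u| <= v.
Proof.
move=> v0; rewrite -[u ^+ 2]real_normK ?num_real//.
by rewrite ler_pXn2r ?nnegrE.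
Qed.

Let bm_f1 : bounded_measurable f1.
Proof.
split.
  by apply: measurable_funM => //; exact: measurable_funB.
exists t^-1 => x; apply: sqr_le_bound; first by rewrite invr_ge0 ltW.
rewrite exprVn (le_trans _ (dV_le x))// -f12E lerDl; exact: sqr_ge0.
Qed.

Let bm_f2 : bounded_measurable f2.
Proof.
split.
  by apply: measurableT_comp => //; exact: measurable_funM.
exists t^-1 => x; apply: sqr_le_bound; first by rewrite invr_ge0 ltW.
rewrite exprVn (le_trans _ (dV_le x))// -f12E lerDr; exact: sqr_ge0.
Qed.

Let bm_h1 : bounded_measurable h1.
Proof. by apply: bounded_measurableD => //; exact: bounded_measurable_cst. Qed.

Let bm_h2 : bounded_measurable h2.
Proof. by apply: bounded_measurableD => //; exact: bounded_measurable_cst. Qed.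

Let V_ge0 : 0 <= V.
Proof. by rewrite subr_ge0 lerD// sqr_expect_le. Qed.

Let V_shift : V = H - (E h1 ^+ 2 + E h2 ^+ 2).
Proof.
have h1E : E h1 = E f1 - s / W.
  by rewrite expectD// ?expect_cst//; exact: bounded_measurable_cst.
have h2E : E h2 = E f2 - - (t / W).
  by rewrite expectD// ?expect_cst//; exact: bounded_measurable_cst.
rewrite /V /H /N h1E h2E.
have e1 : _ = \int[mu]_x (h1 x ^+ 2) - _ := variance_shift mu f1 (s / W) bm_f1.
have e2 : _ = \int[mu]_x (h2 x ^+ 2) - _ := variance_shift mu f2 (- (t / W)) bm_f2.
by rewrite opprD addrACA e1 e2 addrACA -opprD.
Qed.

(** Pointwise, [Im 1/(w-x) = - t |1/(w-x)|^2]. This identity is what makes a variance appear in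
    [Im F_mu(w) - t]. *)
Let expect_f2 : E f2 = - t * (\int[mu]_x (f1 x ^+ 2) + \int[mu]_x (f2 x ^+ 2)).
Proof.
rewrite -expectD; [|exact: bounded_measurableX2..].
rewrite -expectZ.
  by apply: eq_Rintegral => x _; rewrite f12E mulNr.
by apply: bounded_measurableD; exact: bounded_measurableX2.
Qed.

(** For [|x| <= M] one has [d x <= 2 M^2 + 3 t^2], which is [7/8 * C * t^2]. The factor [8/7] makes
    up for the mass, at most [1/8], lying outside [[-M, M]]. *)
Let C := (2 * M ^+ 2 / t ^+ 2 + 3) * 8 / 7.

Let C_gt0 : 0 < C.
Proof.
by have := divr_ge0 (sqr_ge0 M) (sqr_ge0 t); rewrite /C; nra.
Qed.

Let expect_f2_le : (C * t)^-1 <= - E f2.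
Proof.
pose c := (C * 7 / 8 * t)^-1.
have k0 : 0 < C * 7 / 8 * t by rewrite mulr_gt0// divr_gt0// mulr_gt0.
have bA := bounded_measurable_tail M.
have b1 : bounded_measurable (fun x => - c * \1_[set x : R | M < `|x|] x).
  exact: bounded_measurableZ.
have : \int[mu]_x (c + - c * \1_[set x : R | M < `|x|] x) <= \int[mu]_x (-1 * f2 x).
  apply: le_expect.
  - by apply: bounded_measurableD => //; exact: bounded_measurable_cst.
  - exact: bounded_measurableZ.
  - move=> x; rewrite indicE mulN1r opprK; case: (boolP (_ \in _)) => [_|].
      by rewrite mulr1 subrr divr_ge0 ?ltW.
    rewrite notin_setE/= => /negP; rewrite -leNgt => xM.
    rewrite mulr0 addr0 /c.
    rewrite -[leLHS]mul1r ler_pdivrMr// mulrAC ler_pdivlMr// mul1r /C /d.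
    have x2 : x ^+ 2 <= M ^+ 2.
      by rewrite -[x ^+ 2]real_normK ?num_real// ler_pXn2r ?nnegrE// ltW.
    have -> : t * ((2 * M ^+ 2 / t ^+ 2 + 3) * 8 / 7 * 7 / 8 * t) =
        2 * M ^+ 2 + 3 * t ^+ 2 by field; rewrite gt_eqF.
    have := s2t2; have := sqr_ge0 (s + x); lra.
rewrite expectD//; last exact: bounded_measurable_cst.
rewrite expect_cst !expectZ// Rintegral_tail mulN1r.
apply: le_trans.
have c0 : 0 < c by rewrite invr_gt0.
have -> : (C * t)^-1 = c - c * 8^-1.
  by rewrite /c; field; rewrite !gt_eqF.
by rewrite mulNr lerD2l lerN2 ler_wpM2l// ltW.
Qed.

Let N_ge : (C * t) ^- 2 <= N.
Proof.
have Ct0 : 0 < (C * t)^-1 by rewrite invr_gt0 mulr_gt0.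
rewrite -exprVn /N (@le_trans _ _ (E f2 ^+ 2))// ?lerDr ?sqr_ge0//.
rewrite -[E f2 ^+ 2]sqrrN ler_pXn2r ?nnegrE ?(ltW Ct0)//.
exact: le_trans (ltW Ct0) expect_f2_le.
Qed.

Let N_gt0 : 0 < N.
Proof. by apply: lt_le_trans N_ge; rewrite invr_gt0 exprn_gt0// mulr_gt0. Qed.

Let N_le : N <= t ^- 2.
Proof.
apply: (@le_trans _ _ (\int[mu]_x (f1 x ^+ 2) + \int[mu]_x (f2 x ^+ 2))).
  by rewrite -subr_ge0.
rewrite -expectD; [|exact: bounded_measurableX2..].
rewrite -[leRHS](expect_cst mu); apply: le_expect.
- by apply: bounded_measurableD; exact: bounded_measurableX2.
- exact: bounded_measurable_cst.
- by move=> x; rewrite f12E.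
Qed.

(** [Im (1/G) = - Im G / |G|^2], and by [expect_f2] the numerator is [t (V + N)]; subtracting [t]
    leaves the variance. *)
Let ImFE : complex.Im (F_transform mu (s +i* t)%C) - t = t * V / N.
Proof.
have -> : F_transform mu (s +i* t)%C = ((E f1) +i* (E f2))%C^-1.
  rewrite /F_transform /cauchy_transform /cintegral; congr ((_ +i* _)%C^-1).
    by apply: eq_Rintegral => x _; rewrite /= subr0.
  by apply: eq_Rintegral => x _; rewrite /= subr0.
rewrite /= -/N {1}expect_f2 /V mulNr mulNr opprK.
by field; rewrite gt_eqF.
Qed.

Let h12E x : h1 x ^+ 2 + h2 x ^+ 2 = x ^+ 2 / (W * d x).
Proof.
rewrite /h1 /h2 /f1 /f2; have := d_gt0 x; have := W_gt0.
rewrite /W /d => W0 d0.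
by field; rewrite !gt_eqF.
Qed.

Let HE : H = \int[mu]_x (x ^+ 2 / (W * d x)).
Proof.
rewrite /H -expectD; [|exact: bounded_measurableX2..].
by apply: eq_Rintegral => x _; rewrite h12E.
Qed.

Let bm_H : bounded_measurable (fun x => x ^+ 2 / (W * d x)).
Proof.
have -> : (fun x => x ^+ 2 / (W * d x)) = (fun x => h1 x ^+ 2 + h2 x ^+ 2).
  by apply/funext => x; rewrite h12E.
by apply: bounded_measurableD; exact: bounded_measurableX2.
Qed.

Let bm_a : bounded_measurable (fun x => x ^+ 2 / (x ^+ 2 + t ^+ 2)).
Proof. exact: bounded_measurable_sq_div_sqD. Qed.

(** In the cone [|w|^2 <= 2 t^2] and [|w-x|^2 <= 3 (x^2 + t^2)]; the product of the constants is
    6. *)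
Let H_ge : a / (6 * t ^+ 2) <= H.
Proof.
rewrite HE mulrC /a /trunc_moment -expectZ//; apply: le_expect => //.
  exact: bounded_measurableZ.
move=> x; rewrite mulrCA ler_wpM2l ?sqr_ge0// -invfM.
have := sqr_ge0 (s + x) => sx; have s2t2' := s2t2.
have d3 : d x <= 3 * (x ^+ 2 + t ^+ 2) by rewrite /d; have := sqr_ge0 x; nra.
have W2 : W <= 2 * t ^+ 2 by rewrite /W; nra.
rewrite lef_pV2 ?posrE ?mulr_gt0 ?sqD_gt0 ?exprn_gt0//.
have -> : 6 * t ^+ 2 * (x ^+ 2 + t ^+ 2) = (2 * t ^+ 2) * (3 * (x ^+ 2 + t ^+ 2)).
  by ring.
by rewrite ler_pM// ltW.
Qed.

Let H_le : H <= 3 * a / t ^+ 2.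
Proof.
rewrite HE mulrAC /a /trunc_moment -expectZ//; apply: le_expect => //.
  exact: bounded_measurableZ.
move=> x; rewrite mulrCA ler_wpM2l ?sqr_ge0//.
have d3 : x ^+ 2 + t ^+ 2 <= 3 * d x.
  by rewrite /d; have := s2t2; have := sqr_ge0 (x - 2 * s); have := sqr_ge0 (s - x); nra.
have W1 : t ^+ 2 <= W by rewrite /W lerDr sqr_ge0.
rewrite -[leLHS]mul1r ler_pdivrMr ?mulr_gt0//.
have -> : 3 / t ^+ 2 / (x ^+ 2 + t ^+ 2) * (W * d x) =
   (W / t ^+ 2) * ((3 * d x) / (x ^+ 2 + t ^+ 2)).
  by field; rewrite !gt_eqF ?sqD_gt0.
rewrite -[leLHS]mulr1 ler_pM//.
  by rewrite ler_pdivlMr ?exprn_gt0// mul1r.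
by rewrite ler_pdivlMr ?sqD_gt0// mul1r.
Qed.

(** On [|x| <= M] both [|h1|] and [|h2|] are at most [M / t^2], so [sqr_expect_le_tail] bounds the
    squared mean of [h] by [H / 4 + 4 (M / t^2)^2]. Three quarters of [H] remain, and [H_ge] turns
    [3/4 * 1/6] into [1/8]. *)
Let V_ge : a / (8 * t ^+ 2) - 4 * M ^+ 2 / t ^+ 4 <= V.
Proof.
have hb (h : R -> R) : (forall x, h x ^+ 2 <= x ^+ 2 / (W * d x)) ->
    forall x, `|x| <= M -> `|h x| <= M / t ^+ 2.
  move=> hx x xM; apply: sqr_le_bound.
    by rewrite divr_ge0 ?sqr_ge0// ltW.
  apply: (le_trans (hx x)); rewrite expr_div_n.
  rewrite ler_pM ?sqr_ge0 ?invr_ge0 ?mulr_ge0 ?(ltW W_gt0) ?(ltW (d_gt0 _))//.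
    by rewrite -[x ^+ 2]real_normK ?num_real// ler_pXn2r ?nnegrE// ltW.
  rewrite lef_pV2 ?posrE ?mulr_gt0 ?exprn_gt0//.
  by rewrite [leLHS]expr2 ler_pM ?sqr_ge0// lerDr sqr_ge0.
have K0 : 0 <= M / t ^+ 2 by rewrite divr_ge0 ?sqr_ge0// ltW.
have e1 : E h1 ^+ 2 <= 2 * (M / t ^+ 2) ^+ 2 + \int[mu]_x (h1 x ^+ 2) / 4.
  apply: (sqr_expect_le_tail mu h1 _ _ bm_h1 K0 tailM).
  by apply: hb => x; rewrite -h12E lerDl sqr_ge0.
have e2 : E h2 ^+ 2 <= 2 * (M / t ^+ 2) ^+ 2 + \int[mu]_x (h2 x ^+ 2) / 4.
  apply: (sqr_expect_le_tail mu h2 _ _ bm_h2 K0 tailM).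
  by apply: hb => x; rewrite -h12E lerDr sqr_ge0.
have -> : a / (8 * t ^+ 2) = a / (6 * t ^+ 2) * 3 / 4.
  by field; rewrite gt_eqF.
have -> : 4 * M ^+ 2 / t ^+ 4 = 4 * (M / t ^+ 2) ^+ 2.
  by field; rewrite gt_eqF.
rewrite V_shift; move: H_ge e1 e2; rewrite /H; lra.
Qed.

Lemma Im_F_transform_ge : t <= complex.Im (F_transform mu (s +i* t)%C).
Proof.
rewrite -subr_ge0 ImFE divr_ge0 ?(ltW N_gt0)//.
exact: mulr_ge0 (ltW t_gt0) V_ge0.
Qed.

(** Since [N <= t^-2], dividing [t V] by [N t^2] does not decrease it, and [V_ge] applies;
    multiplying through by 8 gives [32 = 8 * 4]. *)
Lemma Im_F_transform_lower : trunc_moment mu t / t <=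
  8 * ((complex.Im (F_transform mu (s +i* t)%C) - t) / t ^+ 2) + 32 * M ^+ 2 / t ^+ 3.
Proof.
rewrite ImFE.
have : t * V <= t * V / N / t ^+ 2.
  have tV0 : 0 <= t * V := mulr_ge0 (ltW t_gt0) V_ge0.
  rewrite -[leRHS]mulrA ler_peMr// -invfM -[leLHS]invr1.
  rewrite lef_pV2 ?posrE ?mulr_gt0 ?exprn_gt0//.
  by have := N_le; rewrite -[t ^- 2]mul1r ler_pdivlMr ?exprn_gt0.
have : t * (a / (8 * t ^+ 2) - 4 * M ^+ 2 / t ^+ 4) <= t * V.
  by rewrite ler_wpM2l// ltW.
have -> : t * (a / (8 * t ^+ 2) - 4 * M ^+ 2 / t ^+ 4) =
    (a / t) / 8 - (4 * M ^+ 2 / t ^+ 3) by field; rewrite gt_eqF.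
rewrite -/a; lra.
Qed.

Lemma Im_F_transform_upper :
  (complex.Im (F_transform mu (s +i* t)%C) - t) / t ^+ 2 <=
  3 * C ^+ 2 * (trunc_moment mu t / t).
Proof.
rewrite ImFE -/a.
have VH : V <= H by rewrite V_shift lerBlDr lerDl addr_ge0 ?sqr_ge0.
have NV : N^-1 <= (C * t) ^+ 2.
  have Ct0 : 0 < (C * t) ^- 2 by rewrite invr_gt0 exprn_gt0// mulr_gt0.
  by rewrite -[leRHS]invrK lef_pV2 ?posrE// N_ge.
have VN : V / N <= (3 * a / t ^+ 2) * (C * t) ^+ 2.
  by rewrite ler_pM ?invr_ge0 ?(ltW N_gt0)// (le_trans VH).
have -> : t * V / N / t ^+ 2 = t^-1 * (V / N) by field; rewrite !gt_eqF.
apply: (@le_trans _ _ (t^-1 * ((3 * a / t ^+ 2) * (C * t) ^+ 2))).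
  by rewrite ler_wpM2l// invr_ge0 ltW.
by rewrite le_eqVlt; apply/orP; left; apply/eqP; field; rewrite gt_eqF.
Qed.

End F_transform_estimates.

(** The constant of [Im_F_transform_upper] decreases in [t], so its value at [T] serves for all
    [t >= T]; integration over the height requires such a uniform constant. *)
Lemma Im_F_transform_upper_unif {R : realType} (mu : probability R R) (s t M T : R) :
  0 < T -> T <= t -> `|s| <= t -> 0 < M ->
  fine (mu [set x | M < `|x|]) <= 8^-1 ->
  (complex.Im (F_transform mu (s +i* t)%C) - t) / t ^+ 2 <=
  3 * ((2 * M ^+ 2 / T ^+ 2 + 3) * 8 / 7) ^+ 2 * (trunc_moment mu t / t).
Proof.
move=> T0 Tt st M0 tailM; have t0 := lt_le_trans T0 Tt.
apply: (le_trans (Im_F_transform_upper mu _ _ _ t0 st M0 tailM)).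
have MtT : M ^+ 2 / t ^+ 2 <= M ^+ 2 / T ^+ 2.
  rewrite ler_wpM2l ?sqr_ge0// lef_pV2 ?posrE ?exprn_gt0//.
  by rewrite ler_pXn2r ?nnegrE ?(ltW t0) ?(ltW T0).
have Mt0 : 0 <= M ^+ 2 / t ^+ 2 by rewrite divr_ge0 ?sqr_ge0.
have at0 : 0 <= trunc_moment mu t / t.
  by rewrite divr_ge0 ?(ltW t0)//; exact: trunc_moment_ge0.
by rewrite ler_wpM2r// ler_wpM2l// ler_pXn2r ?nnegrE//; lra.
Qed.

(** * The Levy-Khintchine function on the imaginary axis *)

Section LK_phi_estimates.
Context {R : realType}.
Variables (gamma : R) (sigma : {finite_measure set R -> \bar R}).
Local Notation phi := (LK_phi gamma sigma).
Let m := fine (sigma setT).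
Let a := trunc_moment sigma.
Implicit Types x y : R.

Let m_ge0 : 0 <= m. Proof. by rewrite fine_ge0. Qed.

Let Im_kernel x y : 0 < y ->
  complex.Im ((1 + (x%:C)%C * (0 +i* y)%C) / ((0 +i* y)%C - (x%:C)%C)) =
  -1 * (y * (1 + x ^+ 2) / (x ^+ 2 + y ^+ 2)).
Proof. by move=> y0 /=; field; rewrite gt_eqF// sqD_gt0. Qed.

Let Re_kernel x y : 0 < y ->
  complex.Re ((1 + (x%:C)%C * (0 +i* y)%C) / ((0 +i* y)%C - (x%:C)%C)) =
  x * (y ^+ 2 - 1) / (x ^+ 2 + y ^+ 2).
Proof. by move=> y0 /=; field; rewrite gt_eqF// sqD_gt0. Qed.

Let measurable_sqDV y : measurable_fun [set: R] (fun x => (x ^+ 2 + y ^+ 2)^-1).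
Proof.
by apply: measurable_funV; apply: measurable_funD => //; exact: measurable_funX.
Qed.

Let Im_kernel_bounds x y : 0 < y ->
  y * (x ^+ 2 / (x ^+ 2 + y ^+ 2)) <= y * (1 + x ^+ 2) / (x ^+ 2 + y ^+ 2)
  <= y * (x ^+ 2 / (x ^+ 2 + y ^+ 2)) + y^-1.
Proof.
move=> y0; have p0 := sqD_gt0 x y y0.
have -> : y * (1 + x ^+ 2) / (x ^+ 2 + y ^+ 2) =
    y * (x ^+ 2 / (x ^+ 2 + y ^+ 2)) + y / (x ^+ 2 + y ^+ 2).
  by field; rewrite gt_eqF.
rewrite lerDl lerD2l divr_ge0 ?(ltW y0) ?(ltW p0)//=.
by rewrite ler_pdivrMr// ler_pdivlMl// -expr2 lerDr sqr_ge0.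
Qed.

Let bm_Im y : 0 < y ->
  bounded_measurable (fun x => y * (1 + x ^+ 2) / (x ^+ 2 + y ^+ 2)).
Proof.
move=> y0; split.
  apply: measurable_funM => //; apply: measurable_funM => //.
  by apply: measurable_funD => //; exact: measurable_funX.
exists (y + y^-1) => x; have /andP[b1 b2] := Im_kernel_bounds x y y0.
have /andP[c1 c2] := sq_div_sqD_itv x y y0.
rewrite ger0_norm; last by rewrite (le_trans _ b1)// mulr_ge0// ltW.
by rewrite (le_trans b2)// lerD2r ler_piMr// ltW.
Qed.

(** The kernel of [- Im phi(iy)] is [y x^2 / (x^2 + y^2)] plus [y / (x^2 + y^2)], and the second
    term lies between 0 and [1/y]. *)
Lemma Im_LK_phi_bounds y : 0 < y ->
  y * a y <= - complex.Im (phi (0 +i* y)%C) <= y * a y + m / y.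
Proof.
move=> y0; have bI := bm_Im _ y0; have bs := bounded_measurable_sq_div_sqD _ y0.
have -> : - complex.Im (phi (0 +i* y)%C) =
    \int[sigma]_x (y * (1 + x ^+ 2) / (x ^+ 2 + y ^+ 2)).
  rewrite /LK_phi /cintegral/= add0r.
  rewrite (@eq_Rintegral _ _ _ sigma setT
    (fun x => -1 * (y * (1 + x ^+ 2) / (x ^+ 2 + y ^+ 2)))); last first.
    by move=> x _; exact: Im_kernel.
  by rewrite RintegralZl// ?mulN1r ?opprK//; exact: bounded_measurable_integrable.
have Ia : y * a y = \int[sigma]_x (y * (x ^+ 2 / (x ^+ 2 + y ^+ 2))).
  by rewrite RintegralZl//; exact: bounded_measurable_integrable.
have Im' : m / y = \int[sigma]_x y^-1 by rewrite Rintegral_cst// mulrC.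
have bc := bounded_measurable_cst y^-1.
have bZ := bounded_measurableZ y _ bs.
rewrite Im' Ia -RintegralD//; try exact: bounded_measurable_integrable.
apply/andP; split; apply: le_Rintegral => //;
  try exact: bounded_measurable_integrable.
- by move=> x _; have /andP[] := Im_kernel_bounds x y y0.
- by apply: bounded_measurable_integrable; exact: bounded_measurableD.
- by move=> x _; have /andP[] := Im_kernel_bounds x y y0.
Qed.

Lemma Im_LK_phi_le0 y : 0 < y -> 0 <= - complex.Im (phi (0 +i* y)%C).
Proof.
move=> y0; have /andP[+ _] := Im_LK_phi_bounds _ y0; apply: le_trans.
by rewrite mulr_ge0 ?(ltW y0)//; exact: trunc_moment_ge0.
Qed.

(** A quantitative form of [phi(iv) = o(v)], which keeps [iv + phi(iv)] in the cone [|s| <= t] with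
    [t >= v/2]. The measure is split at [|x| = N] with tail mass at most [1/4]: the tail contributes
    a small multiple of [v], the rest stays bounded. *)
Lemma LK_phi_small : exists2 v0, 1 <= v0 & forall v, v0 <= v ->
  `|complex.Re (phi (0 +i* v)%C)| <= v / 2 /\ - complex.Im (phi (0 +i* v)%C) <= v / 2.
Proof.
have [|N N0 tailN] := @finite_measure_tail R sigma (4^-1) _; first by [].
set P := fine _ in tailN.
have bA := bounded_measurable_tail N.
have RA : \int[sigma]_x (\1_[set x : R | N < `|x|] x) = P by rewrite Rintegral_tail.
have affine_tail (b c : R) : \int[sigma]_x (b + c * \1_[set x : R | N < `|x|] x) =
    b * m + c * P.
  rewrite RintegralD//.
  - rewrite Rintegral_cst// RintegralZl ?RA//.
    exact: bounded_measurable_integrable.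
  - by apply: bounded_measurable_integrable; exact: bounded_measurable_cst.
  - by apply: bounded_measurable_integrable; exact: bounded_measurableZ.
have bm_affine (b c : R) :
    bounded_measurable (fun x => b + c * \1_[set x : R | N < `|x|] x).
  apply: bounded_measurableD; first exact: bounded_measurable_cst.
  exact: bounded_measurableZ.
(* The two brackets make the bounded remainders of the real and imaginary parts at most [v/4]; the
   summand 1 ensures [v^2 - 1 >= 0]. *)
pose v0 := 1 + 4 * (`|gamma| + N * m) + 4 * ((N ^+ 2 + 1) * m).
have Nm0 : 0 <= N * m by rewrite mulr_ge0// ltW.
have N2m0 : 0 <= (N ^+ 2 + 1) * m by rewrite mulr_ge0// addr_ge0// sqr_ge0.
have g0 := normr_ge0 gamma.
exists v0; first by rewrite /v0; lra.
move=> v v0v.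
have v1 : 1 <= v by rewrite (le_trans _ v0v)// /v0; lra.
have v_gt0 : 0 < v by rewrite (lt_le_trans _ v1).
have vP : v * P <= v / 4 by rewrite ler_wpM2l// ltW.
split.
- have kb x : `|x * (v ^+ 2 - 1) / (x ^+ 2 + v ^+ 2)| <=
      N + (v / 2) * \1_[set x : R | N < `|x|] x.
    have p0 := sqD_gt0 x v v_gt0.
    rewrite normrM [X in _ * X]gtr0_norm ?invr_gt0// normrM.
    rewrite [X in _ * X / _]ger0_norm; last first.
      by rewrite subr_ge0 exprn_ege1.
    rewrite ler_pdivrMr// -[x ^+ 2]real_normK ?num_real//.
    have := normr_ge0 x; rewrite indicE.
    case: (boolP (_ \in _)) => [_|].
      rewrite mulr1; move: `|x| => n n0.
      (* On the tail the kernel is at most [v/2], by [2 n v <= n^2 + v^2]. *)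
      apply: (@le_trans _ _ (v / 2 * (n ^+ 2 + v ^+ 2))).
        have := mulr_ge0 (ltW v_gt0) (sqr_ge0 (n - v)); nra.
      by rewrite ler_wpM2r ?addr_ge0 ?sqr_ge0// lerDr ltW.
    rewrite notin_setE/= => /negP; rewrite -leNgt mulr0 addr0.
    move: `|x| => n nN n0.
    apply: (@le_trans _ _ (n * (n ^+ 2 + v ^+ 2))).
      by rewrite ler_wpM2l//; have := sqr_ge0 n; lra.
    by rewrite ler_wpM2r ?addr_ge0 ?sqr_ge0.
  have bk : bounded_measurable (fun x => x * (v ^+ 2 - 1) / (x ^+ 2 + v ^+ 2)).
    split.
      by apply: measurable_funM => //; exact: measurable_funM.
    have [_ [K hK]] := bm_affine N (v / 2).
    by exists K => x; rewrite (le_trans (kb x))// (le_trans (ler_norm _)).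
  have -> : complex.Re (phi (0 +i* v)%C) =
      gamma + \int[sigma]_x (x * (v ^+ 2 - 1) / (x ^+ 2 + v ^+ 2)).
    rewrite /LK_phi /cintegral/=; congr (_ + _).
    by apply: eq_Rintegral => x _; exact: Re_kernel.
  rewrite (le_trans (ler_normD _ _))//.
  have : `|\int[sigma]_x (x * (v ^+ 2 - 1) / (x ^+ 2 + v ^+ 2))| <= N * m + v / 2 * P.
    rewrite -affine_tail.
    apply: le_trans (le_normr_Rintegral _ _) _ => //.
      exact: bounded_measurable_integrable.
    apply: le_Rintegral => //.
    - exact/integrable_norm/bounded_measurable_integrable.
    - exact: bounded_measurable_integrable.
  by move: v0v; rewrite /v0; lra.
- have /andP[_ +] := Im_LK_phi_bounds _ v_gt0 => /le_trans; apply.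
  have av : a v <= N ^+ 2 / v ^+ 2 * m + 1 * P.
    rewrite -affine_tail; apply: le_Rintegral => //.
    - exact: integrable_trunc_moment.
    - exact: bounded_measurable_integrable.
    - move=> x _; have /andP[c1 c2] := sq_div_sqD_itv x v v_gt0.
      rewrite indicE mul1r; case: (boolP (_ \in _)) => [_|].
        by rewrite ler_wpDl// divr_ge0 ?sqr_ge0.
      rewrite notin_setE/= => /negP; rewrite -leNgt addr0 => xN.
      apply: ler_pM; rewrite ?sqr_ge0 ?invr_ge0 ?addr_ge0 ?sqr_ge0//.
        by rewrite -[x ^+ 2]real_normK ?num_real// ler_pXn2r ?nnegrE// ltW.
      by rewrite lef_pV2 ?posrE ?sqD_gt0 ?exprn_gt0// lerDr sqr_ge0.
  have /le_trans -> // : v * a v + m / v <= (N ^+ 2 + 1) * m / v + v * P.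
    have -> : (N ^+ 2 + 1) * m / v + v * P =
        v * (N ^+ 2 / v ^+ 2 * m + 1 * P) + m / v by field; rewrite gt_eqF.
    by rewrite lerD2r ler_wpM2l// ltW.
  have : (N ^+ 2 + 1) * m / v <= (N ^+ 2 + 1) * m.
    by rewrite ler_pdivrMr// ler_peMr.
  by move: v0v; rewrite /v0; lra.
Qed.

(** The point [1/(iy) = -i/y] lies in the lower half-plane, so [ext_lower] takes its conjugating
    branch; hence the sign. *)
Lemma Im_R_transform y : 0 < y ->
  complex.Im (R_transform gamma sigma (0 +i* y)%C) =
  - complex.Im (phi (0 +i* y^-1)%C).
Proof.
move=> y0; rewrite /R_transform.
have -> : ((0 +i* y)%C)^-1 = (0 -i* y^-1)%C.
  apply/eqP; rewrite eq_complex/=; apply/andP; split; apply/eqP.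
    by rewrite mul0r.
  by congr (- _); field; rewrite gt_eqF.
by rewrite /ext_lower/= oppr_gt0 ltNge invr_ge0 (ltW y0)/= opprK.
Qed.

End LK_phi_estimates.

(** * Equivalence of each integral condition with a logarithmic moment *)

Section log_conditions.
Context {R : realType}.
Implicit Types T : R.

Lemma measurable_invX3 (D : set R) (C : R) : measurable_fun D (fun y => C / y ^+ 3).
Proof.
apply: measurable_funTS; apply: measurable_funM => //; apply: measurable_funV.
exact: measurable_funX.
Qed.

Lemma LK_phi_log_iff (gamma : R) (sigma : {finite_measure set R -> \bar R}) T :
  0 < T ->
  (\int[lebesgue_measure]_(y in `[T, +oo[)
      ((- complex.Im (LK_phi gamma sigma (0 +i* y)%C)) / y ^+ 2)%:E < +oo)%E <->
  (\int[sigma]_x (ln (1 + x ^+ 2))%:E < +oo)%E.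
Proof.
move=> T0; rewrite -(trunc_moment_log sigma T T0).
set m := fine (sigma setT).
have m0 : 0 <= m by rewrite fine_ge0.
have a0 y : T <= y -> 0 <= trunc_moment sigma y / y.
  move=> Ty; have y0 := lt_le_trans T0 Ty.
  by rewrite divr_ge0 ?(ltW y0)//; exact: trunc_moment_ge0.
have m30 y : T <= y -> 0 <= m / y ^+ 3.
  by move=> Ty; rewrite divr_ge0// exprn_ge0// (le_trans (ltW T0)).
have lb y : T <= y -> trunc_moment sigma y / y <=
    (- complex.Im (LK_phi gamma sigma (0 +i* y)%C)) / y ^+ 2 <=
    trunc_moment sigma y / y + m / y ^+ 3.
  move=> Ty; have y0 := lt_le_trans T0 Ty.
  have /andP[h1 h2] := Im_LK_phi_bounds gamma sigma _ y0.
  rewrite ler_pdivlMr ?ler_pdivrMr ?exprn_gt0//.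
  have -> : trunc_moment sigma y / y * y ^+ 2 = y * trunc_moment sigma y.
    by field; rewrite gt_eqF.
  have -> : (trunc_moment sigma y / y + m / y ^+ 3) * y ^+ 2 =
      y * trunc_moment sigma y + m / y.
    by field; rewrite gt_eqF.
  by rewrite h1.
split=> [|aoo].
  apply: le_lt_trans; apply: ge0_le_integral_subset => // y /=;
    rewrite in_itv/= andbT => Ty; rewrite !lee_fin.
    by rewrite a0//=; have /andP[] := lb _ Ty.
  by have /andP[h _] := lb _ Ty; exact: le_trans (a0 _ Ty) h.
(* The integrand is first replaced by its upper bound, which is measurable as [ge0_integral_lty_leD]
   requires. *)
apply: (@le_lt_trans _ _ (\int[lebesgue_measure]_(y in `[T, +oo[)
    (trunc_moment sigma y / y + m / y ^+ 3)%:E)%E).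
  apply: ge0_le_integral_subset => // y /=;
    rewrite in_itv/= andbT => Ty; rewrite lee_fin ?addr_ge0 ?a0 ?m30//.
  have /andP[h1 h2] := lb _ Ty.
  by rewrite (le_trans (a0 _ Ty) h1) lee_fin.
move: aoo (@integral_invX3_lty R T m T0 m0).
apply: (@ge0_integral_lty_leD _ _ _ _ _ _ _ _ 1) => //.
- apply: measurable_funD; first exact: measurable_trunc_moment_div.
  exact: measurable_invX3.
- exact: measurable_invX3.
- by move=> y /=; rewrite in_itv/= andbT => Ty; exact: a0.
- by move=> y /=; rewrite in_itv/= andbT => Ty; rewrite addr_ge0 ?a0 ?m30.
- by move=> y /=; rewrite in_itv/= andbT => Ty; exact: m30.
- by move=> y _; rewrite mul1r.
Qed.

(** [Im_LK_phi_bounds] at height [1/y] gives the same squeeze, now with the error [m y], which is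
    bounded on the interval. *)
Lemma R_transform_log_iff (gamma : R) (sigma : {finite_measure set R -> \bar R}) T :
  0 < T ->
  (\int[lebesgue_measure]_(y in `]0%R, (T^-1)%R])
      (complex.Im (R_transform gamma sigma (0 +i* y)%C))%:E < +oo)%E <->
  (\int[sigma]_x (ln (1 + x ^+ 2))%:E < +oo)%E.
Proof.
move=> T0; rewrite -(trunc_moment_log0 sigma T T0).
set m := fine (sigma setT).
have m0 : 0 <= m by rewrite fine_ge0.
have a0 y : 0 < y -> 0 <= trunc_moment sigma y^-1 / y.
  by move=> y0; rewrite divr_ge0 ?(ltW y0)//; exact: trunc_moment_ge0.
have my0 y : 0 < y -> 0 <= m * y by move=> y0; rewrite mulr_ge0// ltW.
have lb y : 0 < y -> trunc_moment sigma y^-1 / y <=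
    complex.Im (R_transform gamma sigma (0 +i* y)%C) <=
    trunc_moment sigma y^-1 / y + m * y.
  move=> y0; have yV0 : 0 < y^-1 by rewrite invr_gt0.
  have := Im_LK_phi_bounds gamma sigma _ yV0.
  by rewrite Im_R_transform// invrK [y^-1 * _]mulrC.
split=> [|aoo].
  apply: le_lt_trans; apply: ge0_le_integral_subset => // y /=;
    rewrite in_itv/= => /andP[y0 _]; rewrite !lee_fin.
    by rewrite a0//=; have /andP[] := lb _ y0.
  by have /andP[h _] := lb _ y0; exact: le_trans (a0 _ y0) h.
apply: (@le_lt_trans _ _ (\int[lebesgue_measure]_(y in `]0%R, (T^-1)%R])
    (trunc_moment sigma y^-1 / y + m * y)%:E)%E).
  apply: ge0_le_integral_subset => // y /=;
    rewrite in_itv/= => /andP[y0 _]; rewrite lee_fin ?addr_ge0 ?a0 ?my0//.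
  have /andP[h1 h2] := lb _ y0.
  by rewrite (le_trans (a0 _ y0) h1) lee_fin.
have mm : measurable_fun (`]0%R, (T^-1)%R]%classic : set R) (fun y : R => m * y).
  by apply: measurable_funTS; exact: measurable_funM.
move: aoo (@integral_linear0_lty R T m T0 m0).
apply: (@ge0_integral_lty_leD _ _ _ _ _ _ _ _ 1) => //.
- apply: measurable_funD => //; apply: measurable_funTS.
  apply: measurable_funM; last exact: measurable_funV.
  by apply: measurableT_comp; [exact: measurable_trunc_moment|exact: measurable_invr].
- by move=> y /=; rewrite in_itv/= => /andP[y0 _]; exact: a0.
- by move=> y /=; rewrite in_itv/= => /andP[y0 _]; rewrite addr_ge0 ?a0 ?my0.
- by move=> y /=; rewrite in_itv/= => /andP[y0 _]; exact: my0.
- by move=> y _; rewrite mul1r.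
Qed.

(** Common frame for the two quantities compared with [a_mu(y) / y]: [(Im F_mu(iy) - y) / y^2] and
    [- Im phi(iy) / y^2]. The term [B / y^3] is integrable at infinity. *)
Lemma comparable_log_iff (mu : probability R R) (f : R -> R) (T A B C : R) :
  0 < T -> 0 < A -> 0 <= B -> 0 <= C ->
  (forall y, T <= y -> [/\ 0 <= f y,
     trunc_moment mu y / y <= A * f y + B / y ^+ 3 &
     f y <= C * (trunc_moment mu y / y)]) ->
  (\int[lebesgue_measure]_(y in `[T, +oo[) (f y)%:E < +oo)%E <->
  (\int[mu]_x (ln (1 + x ^+ 2))%:E < +oo)%E.
Proof.
move=> T0 A0 B0 C0 hf; rewrite -(trunc_moment_log mu T T0).
have a0 y : T <= y -> 0 <= trunc_moment mu y / y.
  move=> Ty; have y0 := lt_le_trans T0 Ty.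
  by rewrite divr_ge0 ?(ltW y0)//; exact: trunc_moment_ge0.
have B30 y : T <= y -> 0 <= B / y ^+ 3.
  by move=> Ty; rewrite divr_ge0// exprn_ge0// (le_trans (ltW T0)).
split=> [foo|aoo].
  move: foo (@integral_invX3_lty R T B T0 B0).
  apply: (@ge0_integral_lty_leD _ _ _ _ _ _ _ _ A) => //.
  - exact: measurable_trunc_moment_div.
  - exact: measurable_invX3.
  - by move=> y /=; rewrite in_itv/= andbT => /hf[].
  - by move=> y /=; rewrite in_itv/= andbT => Ty; exact: a0.
  - by move=> y /=; rewrite in_itv/= andbT => Ty; exact: B30.
  - by move=> y /=; rewrite in_itv/= andbT => /hf[].
apply: (@le_lt_trans _ _ (\int[lebesgue_measure]_(y in `[T, +oo[)
    (C%:E * (trunc_moment mu y / y)%:E))%E).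
  apply: ge0_le_integral_subset => // y /=;
    rewrite in_itv/= andbT => Ty; rewrite lee_fin.
    by have [h1 _ h2] := hf _ Ty; rewrite h1 lee_fin.
  by rewrite mulr_ge0// a0.
rewrite ge0_integralZl_EFin//.
- by rewrite lte_mul_pinfty// lee_fin.
- by move=> y /=; rewrite in_itv/= andbT => Ty; rewrite lee_fin a0.
- by apply/measurable_EFinP; exact: measurable_trunc_moment_div.
Qed.

Lemma F_transform_log_iff (mu : probability R R) T : 0 < T ->
  (\int[lebesgue_measure]_(y in `[T, +oo[)
      ((complex.Im (F_transform mu (0 +i* y)%C) - y) / y ^+ 2)%:E < +oo)%E <->
  (\int[mu]_x (ln (1 + x ^+ 2))%:E < +oo)%E.
Proof.
move=> T0; have [//|M M0 tailM] := @finite_measure_tail R mu (8^-1) _.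
apply: (@comparable_log_iff _ _ _ 8 (32 * M ^+ 2)
    (3 * ((2 * M ^+ 2 / T ^+ 2 + 3) * 8 / 7) ^+ 2)) => //.
- by rewrite mulr_ge0// sqr_ge0.
- by rewrite mulr_ge0// sqr_ge0.
- move=> y Ty; have y0 := lt_le_trans T0 Ty.
  have s0 : `|0 : R| <= y by rewrite normr0 ltW.
  split.
  + rewrite divr_ge0 ?sqr_ge0// subr_ge0; exact: Im_F_transform_ge M0 tailM.
  + exact: Im_F_transform_lower.
  + exact: Im_F_transform_upper_unif.
Qed.

(* At [w = iv + phi(iv)] one has [F w = iv], so that [- Im phi(iv) = Im (F w) - Im w],
   where [w] stays in a cone and [Im w] is comparable to [v]. *)
Lemma generating_pair_log_iff (mu : probability R R) (gamma : R)
    (sigma : {finite_measure set R -> \bar R}) :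
  free_generating_pair mu gamma sigma ->
  (\int[mu]_x (ln (1 + x ^+ 2))%:E < +oo)%E <->
  (\int[sigma]_x (ln (1 + x ^+ 2))%:E < +oo)%E.
Proof.
move=> [alpha [beta [alpha0 [beta0 inv]]]].
have [//|M M0 tailM] := @finite_measure_tail R mu (8^-1) _.
have [v0 v01 small] := LK_phi_small gamma sigma.
(* For [v >= T] the point [iv] is in the truncated cone and [phi(iv)] is small. This cutoff may be
   chosen freely, as [LK_phi_log_iff] holds for every positive one. *)
pose T := v0 + beta.
have T0 : 0 < T by rewrite /T; lra.
rewrite -(LK_phi_log_iff gamma sigma T T0); apply: iff_sym.
(* The uniform upper constant at [T/2], because [Im w] is only known to be at least [v/2]. *)
pose C := 3 * ((2 * M ^+ 2 / (T / 2) ^+ 2 + 3) * 8 / 7) ^+ 2.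
have C0 : 0 <= C by rewrite mulr_ge0// sqr_ge0.
(* Passing from [t = Im w] to [v <= 2 t] costs powers of 2: [32 = 8 * 2^2], [256 = 32 * 2^3], and
   [8 = 4 * 2] with the 4 from [trunc_moment_half]. *)
apply: (@comparable_log_iff _ _ _ 32 (256 * M ^+ 2) (8 * C)) => //.
- by rewrite mulr_ge0// sqr_ge0.
- by rewrite mulr_ge0.
move=> v Tv; have v_gt0 := lt_le_trans T0 Tv.
have [|s_le p_le] := small v; first by move: Tv; rewrite /T; lra.
have p_ge0 := Im_LK_phi_le0 gamma sigma _ v_gt0.
have [|_ Fw] := inv (0 +i* v)%C.
  rewrite /trunc_cone/= normr0 mulr_gt0//; split => //.
  by move: Tv; rewrite /T; lra.
move: Fw s_le p_le p_ge0; case: (LK_phi gamma sigma (0 +i* v)%C) => s q /=.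
move=> Fw s_le p_le p_ge0; set t := v + q.
have {}Fw : F_transform mu (s +i* t)%C = (0 +i* v)%C.
  rewrite -[RHS]Fw; congr (F_transform mu _).
  by apply/eqP; rewrite eq_complex/= add0r !eqxx.
have t_gt0 : 0 < t by rewrite /t; lra.
have tv : t <= v by rewrite /t; lra.
have vt : v <= 2 * t by rewrite /t; lra.
have st : `|s| <= t by rewrite (le_trans s_le)// /t; lra.
have Tt : T / 2 <= t by move: Tv; lra.
have T20 : 0 < T / 2 by rewrite divr_gt0.
have := Im_F_transform_upper_unif mu _ _ _ _ T20 Tt st M0 tailM.
have := Im_F_transform_lower mu _ _ _ t_gt0 st M0 tailM.
rewrite Fw/= -/C.
have -> : v - t = - q by rewrite /t; ring.
have aV (y z : R) : 0 < y -> y <= z -> z^-1 <= y^-1.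
  by move=> y0 yz; rewrite lef_pV2 ?posrE// (lt_le_trans y0).
have tVX n : t ^- n <= 2 ^+ n * v ^- n.
  rewrite -(invrK (2 ^+ n)) -invfM aV//.
    by rewrite mulr_gt0 ?invr_gt0 ?exprn_gt0.
  rewrite ler_pdivrMl ?exprn_gt0// -exprMn.
  by apply: lerXn2r; rewrite ?nnegrE// ?mulr_ge0// ltW.
move=> lower upper; split.
- by rewrite divr_ge0 ?sqr_ge0.
- apply: (@le_trans _ _ (trunc_moment mu t / t)).
    apply: ler_pM; rewrite ?invr_ge0 ?(ltW v_gt0) ?aV//.
      exact: trunc_moment_ge0.
    exact: trunc_moment_nincr.
  apply: (le_trans lower).
  have h2 := ler_wpM2l p_ge0 (tVX 2).
  have M20 : 0 <= 32 * M ^+ 2 by rewrite mulr_ge0// sqr_ge0.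
  have h3 := ler_wpM2l M20 (tVX 3).
  have -> : 32 * (- q / v ^+ 2) + 256 * M ^+ 2 / v ^+ 3 =
      8 * (- q * (2 ^+ 2 * v ^- 2)) + 32 * M ^+ 2 * (2 ^+ 3 * v ^- 3).
    by ring.
  by rewrite lerD// ler_wpM2l.
- apply: (@le_trans _ _ (- q / t ^+ 2)).
    rewrite ler_wpM2l// aV ?exprn_gt0//.
    by rewrite ler_pXn2r ?nnegrE ?(ltW v_gt0) ?(ltW t_gt0).
  apply: (le_trans upper).
  have -> : 8 * C * (trunc_moment mu v / v) =
      C * ((4 * trunc_moment mu v) * (2 ^+ 1 * v ^- 1)).
    by rewrite !expr1; ring.
  rewrite ler_wpM2l//; apply: ler_pM.
  + exact: trunc_moment_ge0.
  + by rewrite invr_ge0 ltW.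
  + exact: trunc_moment_half.
  + exact: (tVX 1%N).
Qed.

End log_conditions.

Theorem theorem6p1 (R : realType) (mu : probability R R) (gamma : R)
  (sigma : {finite_measure set R -> \bar R}) (T : R) :
  0 < T ->
  free_generating_pair mu gamma sigma ->
  [<->
    (\int[mu]_x (ln (1 + x ^+ 2))%:E < +oo)%E;
    (\int[sigma]_x (ln (1 + x ^+ 2))%:E < +oo)%E;
    (\int[lebesgue_measure]_(y in (`[T, +oo[)%classic)
        ((- complex.Im (LK_phi gamma sigma (0 +i* y)%C)) / y ^+ 2)%:E < +oo)%E;
    (\int[lebesgue_measure]_(y in (`]0%R, (T^-1)%R])%classic)
        (complex.Im (R_transform gamma sigma (0 +i* y)%C))%:E < +oo)%E;
    (\int[lebesgue_measure]_(y in (`[T, +oo[)%classic)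
        ((complex.Im (F_transform mu (0 +i* y)%C) - y) / y ^+ 2)%:E < +oo)%E
  ].
Proof.
move=> T0 pair.
have mu_sigma := generating_pair_log_iff mu gamma sigma pair.
have phi_sigma := LK_phi_log_iff gamma sigma T T0.
have R_sigma := R_transform_log_iff gamma sigma T T0.
have F_mu := F_transform_log_iff mu T T0.
tfae; tauto.
Qed.
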